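(* Let $\Sigma$ be a finite alphabet and let $\textsc{Transparent}$ denote the class of all strongly transparent languages over $\Sigma$. Then $\textsc{Transparent}$ is $\aleph$-emulatable.
   Context: Setting. $\Sigma$ is a finite alphabet, $\lambda$ is the empty string, $(\Sigma^\star)^2$ is the set of pairs of strings. A pair $\kappa=\langle l,r\rangle\in(\Sigma^\star)^2$ is called a context, and $\lambda^2=\langle\lambda,\lambda\rangle$ is the empty context. $Y$ is a countable set of referents containing a special null symbol $\emptyset\in Y$. Language with semantics. A language $L$ is a set of strings $L\subseteq\Sigma^\star$ together with a denotation function assigning to each $e\in\Sigma^\star$ and each context $\kappa$ a value $[\![e\mid\kappa]\!]_L\in Y$ (intuitively the value of $e$ when it occurs in the larger string $ler\in L$, where $\kappa=\langle l,r\rangle$). One has $[\![e\mid\kappa]\!]_L=\emptyset$ iff $e$ is not a valid expression in the context $\kappa$. The support of a context is $\mathrm{supp}_L(\kappa)=\{e\in\Sigma^\star : [\![e\mid\kappa]\!]_L\neq\emptyset\}$. No compositionality is assumed. Strong transparency. $L$ is strongly transparent iff for all $e\in\Sigma^\star$ and all $\kappa\in(\Sigma^\star)^2$, either $[\![e\mid\kappa]\!]_L=[\![e\mid\lambda^2]\!]_L\neq\emptyset$, or $[\![e\mid\kappa]\!]_L=\emptyset$. Assertion oracle. For $e,e'\in\Sigma^\star$ and $\kappa\in(\Sigma^\star)^2$, $\aleph_L(e,e'\mid\kappa)=1$ if $[\![e\mid\kappa]\!]_L=[\![e'\mid\kappa]\!]_L$, and $\aleph_L(e,e'\mid\kappa)=0$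 otherwise. Oracle machines. For an oracle Turing machine $\mu$, $\mu_L(e)$ denotes the output of $\mu$ on input $e$ when its oracle is $\aleph_L$ (the machine may query $\aleph_L$ on any triple $(e_1,e_2,\kappa)$). $\aleph$-emulation. A class $\mathcal L$ of languages over $\Sigma$ is $\aleph$-emulatable if there exist a single oracle Turing machine $\mu$ and a single standard Turing machine $\delta$ (with no oracle) such that for all $L\in\mathcal L$, all $\kappa\in(\Sigma^\star)^2$ and all $e,e'\in\mathrm{supp}_L(\kappa)$, the computations $\mu_L(e)$, $\mu_L(e')$ and $\delta(\mu_L(e),\mu_L(e')\mid\kappa)$ halt and $$[\![e\mid\kappa]\!]_L=[\![e'\mid\kappa]\!]_L\iff \delta\big(\mu_L(e),\mu_L(e')\mid\kappa\big),$$ where the right-hand side means that $\delta$, given the two outputs and $\kappa$ as input, accepts (outputs $1$). *)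

(* Defs.v *)
From HB Require Import structures.
From mathcomp Require Import all_boot.

Set Implicit Arguments.
Unset Strict Implicit.
Unset Printing Implicit Defensive.

(** * Languages with semantics *)

Definition context (Sigma : Type) : Type := (seq Sigma * seq Sigma)%type.

Definition empty_context (Sigma : Type) : context Sigma := ([::], [::]).

(* No condition relates [den] to [strings]: the denotation is a total function
   of (e, <l, r>), and "e is a valid expression in kappa" has no other meaning
   than [den e kappa <> null]. *)
Record language (Sigma Y : Type) := Language {
  strings : seq Sigma -> Prop;
  den : seq Sigma -> context Sigma -> Y
}.

Section Languages.
Variables (Sigma : Type) (Y : countType) (null : Y).
Implicit Types (L : language Sigma Y) (e : seq Sigma) (kappa : context Sigma).

Definition supp L kappa : seq Sigma -> Prop :=
  fun e => den L e kappa <> null.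

Definition strongly_transparent L : Prop :=
  forall e kappa,
    (den L e kappa = den L e (empty_context Sigma)
       /\ den L e (empty_context Sigma) <> null)
    \/ den L e kappa = null.

Definition assertion_oracle L e e' kappa : bool :=
  den L e kappa == den L e' kappa.

End Languages.

(** * Tapes *)

(* A cell is [Some s], or [None] when blank.  [Tape l r] is the two-way infinite
   tape with the cells of [l] to the left of the head, nearest first, the head
   on the first cell of [r], the rest of [r] to its right, and blanks beyond. *)
Record tape (S : Type) := Tape { lpart : seq (option S); rpart : seq (option S) }.

Inductive move := MoveLeft | Stay | MoveRight.

Section Tapes.
Variable S : Type.
Implicit Types t : tape S.

Definition blank_tape : tape S := Tape [::] [::].

(* The head is on the first symbol of the loaded string. *)
Definition load (s : seq S) : tape S := Tape [::] (map Some s).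

(* The non-blank symbols from left to right, wherever the head is. *)
Definition contents t : seq S := pmap id (rev (lpart t) ++ rpart t).

Definition scan t : option S := head None (rpart t).

Definition write (c : option S) t : tape S :=
  Tape (lpart t) (c :: behead (rpart t)).

Definition shift (m : move) t : tape S :=
  match m with
  | MoveLeft => Tape (behead (lpart t)) (head None (lpart t) :: rpart t)
  | Stay => t
  | MoveRight => Tape (head None (rpart t) :: lpart t) (behead (rpart t))
  end.

End Tapes.

(** * Turing machines *)

(* Deterministic multitape machines with input alphabet [A] and [p] reserved
   tapes (inputs, outputs, queries), followed by [work] further tapes.  The tape
   alphabet adds auxiliary symbols to [A].  [trans q cells = None] means that
   the machine halts; otherwise it gives the next state and, for each tape, the
   cell content to write and the head move. *)
Record machine (A : finType) (p : nat) := Machine {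
  aux : finType;
  work : nat;
  state : finType;
  start : state;
  trans : state -> (p + work).-tuple (option (A + aux)) ->
          option (state * (p + work).-tuple (option (A + aux) * move))
}.

Definition symbol (A : finType) p (M : machine A p) : finType := (A + aux M)%type.

Definition config (A : finType) p (M : machine A p) : Type :=
  (state M * (p + work M).-tuple (tape (symbol M)))%type.

Section Runs.
Variables (A : finType) (p : nat) (M : machine A p).

(* The i-th string is loaded on tape i; the remaining tapes are blank. *)
Definition initial (inputs : seq (seq A)) : config M :=
  (start M,
   [tuple load (map (fun a => inl a : symbol M) (nth [::] inputs i)) | i < p + work M]).

Definition tape_at (c : config M) (i : nat) : tape (symbol M) :=
  nth (blank_tape _) c.2 i.

Definition machine_step (c : config M) : option (config M) :=
  match trans c.1 (map_tuple (@scan _) c.2) with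
  | None => None
  | Some (q, acts) =>
      Some (q, [tuple shift (tnth acts i).2 (write (tnth acts i).1 (tnth c.2 i))
               | i < p + work M])
  end.

Definition halts_at (step : config M -> option (config M)) (c c' : config M) : Prop :=
  (exists n, iter n (obind step) (Some c) = Some c') /\ step c' = None.

End Runs.

(* An oracle machine has six reserved tapes: 0 holds the input, 1 the output,
   and 2, 3, 4, 5 the components e1, e2, l, r of a query (e1, e2, <l, r>).
   [query q = Some (q1, q0)] says that q is a query state: the machine then
   enters q1 or q0 according to the oracle's answer, its tapes unchanged. *)
Record oracle_machine (Sigma : finType) := OracleMachine {
  om_machine :> machine Sigma 6;
  query : state om_machine -> option (state om_machine * state om_machine)
}.

Section OracleRuns.
Variables (Sigma : finType) (mu : oracle_machine Sigma).
Variable oracle : seq Sigma -> seq Sigma -> context Sigma -> bool.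

(* Auxiliary symbols are not part of a query. *)
Definition query_string (c : config mu) (i : nat) : seq Sigma :=
  pmap (fun s : symbol mu => if s is inl a then Some a else None)
       (contents (tape_at c i)).

Definition oracle_step (c : config mu) : option (config mu) :=
  match query c.1 with
  | Some (q1, q0) =>
      let answer := oracle (query_string c 2) (query_string c 3)
                           (query_string c 4, query_string c 5) in
      Some (if answer then q1 else q0, c.2)
  | None => machine_step c
  end.

Definition oracle_computes (e : seq Sigma) (o : seq (symbol mu)) : Prop :=
  exists c, halts_at oracle_step (initial mu [:: e]) c /\ contents (tape_at c 1) = o.

End OracleRuns.

Record decider (A : finType) (p : nat) := Decider {
  dec_machine :> machine A p;
  accepting : pred (state dec_machine)
}.

(* The machine halts on the given inputs, with verdict [b]. *)
Definition decides (A : finType) p (delta : decider A p)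
    (inputs : seq (seq A)) (b : bool) : Prop :=
  exists c, halts_at (@machine_step _ _ delta) (initial delta inputs) c
            /\ accepting c.1 = b.

(** * Emulation *)

(* The outputs of [mu] are strings over its tape alphabet, which is therefore
   the input alphabet of [delta]; a letter of Sigma in kappa is the same letter
   in that alphabet.  Runs being deterministic, [o], [o'] and [b] are the
   outputs of the three computations. *)
Definition emulates (Sigma : finType) (Y : countType) (null : Y)
    (mu : oracle_machine Sigma) (delta : decider (symbol mu) 4)
    (L : language Sigma Y) : Prop :=
  forall (kappa : context Sigma) (e e' : seq Sigma),
    supp null L kappa e -> supp null L kappa e' ->
    exists (o o' : seq (symbol mu)) (b : bool),
      [/\ oracle_computes (assertion_oracle L) e o,
          oracle_computes (assertion_oracle L) e' o',
          decides delta
            [:: o; o'; map (fun a => inl a : symbol mu) kappa.1;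
                       map (fun a => inl a : symbol mu) kappa.2] b
        & den L e kappa = den L e' kappa <-> b].

Definition emulatable (Sigma : finType) (Y : countType) (null : Y)
    (C : language Sigma Y -> Prop) : Prop :=
  exists (mu : oracle_machine Sigma) (delta : decider (symbol mu) 4),
    forall L, C L -> emulates null delta L.

(* Main.v *)
(** A transparent denotation can be read off in the empty context, so [mu]
    replaces [e] by a canonical representative of its class: the first string,
    in a fixed enumeration, that the oracle equates with [e] in the empty
    context.  The search stops at [e] at the latest, and two expressions with
    the same support context are equivalent iff their representatives are equal
    strings, which [delta] checks letter by letter. *)
Require Import Defs.
From HB Require Import structures.
From mathcomp Require Import all_boot.

Set Implicit Arguments.
Unset Strict Implicit.
Unset Printing Implicit Defensive.

(** * Enumeration of strings *)

Section Enumeration.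
Variable Sigma : finType.
Implicit Types (a b : Sigma) (s : seq Sigma).

Definition next_letter a : option Sigma :=
  ohead (drop (index a (enum Sigma)).+1 (enum Sigma)).

(* Increment in bijective base-#|Sigma| numeration, least significant digit
   first. *)
Fixpoint successor s : seq Sigma :=
  match s with
  | [::] => take 1 (enum Sigma)
  | a :: s' => if next_letter a is Some b then b :: s'
               else head a (enum Sigma) :: successor s'
  end.

Lemma next_letter_nth a i : i < size (enum Sigma) ->
  next_letter (nth a (enum Sigma) i) =
    if i.+1 < size (enum Sigma) then Some (nth a (enum Sigma) i.+1) else None.
Proof.
move=> lti; rewrite /next_letter index_uniq ?enum_uniq //.
by case: ltnP => [lt|le]; [rewrite (drop_nth a lt) | rewrite drop_oversize].
Qed.

Lemma iter_successor_digit a s i : i < size (enum Sigma) ->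
  iter i successor (head a (enum Sigma) :: s) = nth a (enum Sigma) i :: s.
Proof.
elim: i => [|i IHi] lti; first by rewrite nth0.
by rewrite iterS IHi ?(ltnW lti) //= next_letter_nth ?lti ?(ltnW lti).
Qed.

(** All but one of these steps bring the first digit to the last letter, so the final step
    carries. *)
Lemma iter_successor_carry a s :
  iter (size (enum Sigma)) successor (head a (enum Sigma) :: s) =
    head a (enum Sigma) :: successor s.
Proof.
have := mem_enum Sigma a; rewrite inE -index_mem.
case Dn: (size _) => [//|n] _.
have ltn : n < size (enum Sigma) by rewrite Dn.
rewrite iterS (iter_successor_digit _ _ ltn) /= next_letter_nth // Dn ltnn.
(* The two heads differ only in their default value, and the alphabet is nonempty. *)
by rewrite -!nth0 (set_nth_default a) ?Dn.
Qed.

(** Induction on the string: the steps that produce the tail become full cycles of the first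
    digit. *)
Lemma successor_onto s : exists n, iter n successor [::] = s.
Proof.
elim: s => [|a s [n <-]]; first by exists 0.
have start1 : successor [::] = [:: head a (enum Sigma)].
  by have := mem_enum Sigma a; rewrite inE /=; case: (enum Sigma) => // b [|].
have block m : iter (m * size (enum Sigma)) successor [:: head a (enum Sigma)]
    = head a (enum Sigma) :: iter m successor [::].
  by elim: m => // m IHm; rewrite mulSn iterD IHm iter_successor_carry.
have lta : index a (enum Sigma) < size (enum Sigma) by rewrite index_mem mem_enum.
(* One step creates the first digit, [n] full cycles produce the tail, and the rest advance the
   first digit to [a]. *)
exists (index a (enum Sigma) + (n * size (enum Sigma)).+1).
by rewrite iterD iterSr start1 block iter_successor_digit // nth_index ?mem_enum.
Qed.

End Enumeration.

(** * Tapes and runs *)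

(** Each step of the two machines below performs one common action on a few tapes and leaves the
    others idle. *)
Definition act_on (S : Type) n (J : seq nat) (act : option S * move)
    (cells : n.-tuple (option S)) : n.-tuple (option S * move) :=
  [tuple if (i : nat) \in J then act else (tnth cells i, Stay) | i < n].

Section Runs.
Variables (A : finType) (p : nat) (M : machine A p).
Implicit Types (c : config M) (step : config M -> option (config M)).

Definition reaches step c c' := exists n, iter n (obind step) (Some c) = Some c'.

Lemma reaches_refl step c : reaches step c c.
Proof. by exists 0. Qed.

Lemma reaches_step step c c1 c2 :
  step c = Some c1 -> reaches step c1 c2 -> reaches step c c2.
Proof. by move=> E [n Dn]; exists n.+1; rewrite iterSr /= E. Qed.

Lemma reaches_trans step c1 c2 c3 :
  reaches step c1 c2 -> reaches step c2 c3 -> reaches step c1 c3.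
Proof. by move=> [m Dm] [n Dn]; exists (n + m); rewrite iterD Dm. Qed.

Lemma scan_tape_at c i :
  nth None (map_tuple (@scan _) c.2) i = scan (tape_at c i).
Proof.
rewrite /tape_at /=; have [lti|lei] := ltnP i (size c.2).
  by rewrite (nth_map (blank_tape _)).
by rewrite !nth_default ?size_map.
Qed.

(* A tape outside [J] is rewritten with the cell just read, which may turn an
   implicit blank into an explicit one. *)
Lemma machine_step_act_on c q J act :
    trans c.1 (map_tuple (@scan _) c.2) =
      Some (q, act_on J act (map_tuple (@scan _) c.2)) ->
  exists c', [/\ machine_step c = Some c', c'.1 = q
    & forall i, i < p + work M ->
      tape_at c' i = if i \in J then shift act.2 (write act.1 (tape_at c i))
                     else write (scan (tape_at c i)) (tape_at c i)].
Proof.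
move=> E; rewrite /machine_step E; eexists; split=> // i lti.
rewrite {1}/tape_at /= (nth_mktuple _ _ (Ordinal lti)) tnth_mktuple /=.
rewrite tnth_map /tape_at !(tnth_nth (blank_tape _)) /=.
by case: ifP.
Qed.

End Runs.

(** At most one blank becomes explicit, and [contents] discards blanks. *)
Lemma contents_write_scan (S : Type) (t : tape S) :
  contents (write (scan t) t) = contents t.
Proof. by case: t => l [|c r]; rewrite /contents //= !pmap_cat. Qed.

Lemma pmap_id_nseq_None (S : Type) n : pmap id (nseq n (@None S)) = [::].
Proof. by elim: n. Qed.

(** * The searching machine *)

Inductive phase := Copy | Ask | Increment | Rewind | Found.

Definition nat_of_phase q :=
  match q with Copy => 0 | Ask => 1 | Increment => 2 | Rewind => 3 | Found => 4 end.

Definition phase_of_nat n :=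
  nth None [:: Some Copy; Some Ask; Some Increment; Some Rewind; Some Found] n.

Lemma nat_of_phaseK : pcancel nat_of_phase phase_of_nat.
Proof. by case. Qed.

HB.instance Definition _ := Countable.copy phase (pcan_type nat_of_phaseK).

Lemma phase_enumP : Finite.axiom [:: Copy; Ask; Increment; Rewind; Found].
Proof. by case. Qed.

HB.instance Definition _ := isFinite.Build phase phase_enumP.

Section Search.
Variable Sigma : finType.

Local Notation cell := (option (Sigma + void)).

(** One digit of [successor]; the boolean is true when no carry remains. A blank marks the end of
    the string. *)
Definition increment_cell (c : cell) : cell * bool :=
  match c with
  | Some (inl a) =>
      if next_letter a is Some b then (Some (inl b), true)
      else (Some (inl (head a (enum Sigma))), false)
  | _ => (omap inl (ohead (enum Sigma)), true)
  end.

(** Here [x] is read on tape 0 and [d] on tape 3. Tapes 1 and 3 hold the same candidate, so the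
    output is in place when the oracle answers yes; tapes 4 and 5 stay blank, so every query is made
    in the empty context. *)
Definition search_actions (q : phase) (x d : cell) :
    option (phase * (seq nat * (cell * move))) :=
  match q with
  | Copy => Some (if x is Some _ then (Copy, ([:: 0; 2], (x, MoveRight)))
                  else (Ask, ([::], (None, Stay))))
  | Increment =>
      let: (d', done) := increment_cell d in
      Some (if done then (Rewind, ([:: 1; 3], (d', MoveLeft)))
            else (Increment, ([:: 1; 3], (d', MoveRight))))
  | Rewind => Some (if d is Some _ then (Rewind, ([:: 1; 3], (d, MoveLeft)))
                    else (Ask, ([:: 1; 3], (None, MoveRight))))
  | Ask | Found => None
  end.

Definition search_machine : machine Sigma 6 :=
  @Machine Sigma 6 void 0 phase Copy
    (fun q cells =>
       if search_actions q (nth None cells 0) (nth None cells 3)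
         is Some (q', (J, act)) then
         Some (q', act_on J act cells)
       else None).

Definition search : oracle_machine Sigma :=
  @OracleMachine Sigma search_machine
    (fun q => if q is Ask then Some (Found, Increment) else None).

Variable oracle : seq Sigma -> seq Sigma -> context Sigma -> bool.
Implicit Types (c : config search) (e s u : seq Sigma) (T : tape (symbol search)).

Local Notation run := (reaches (oracle_step oracle)).

Lemma search_step c q J act :
    c.1 != Ask ->
    search_actions c.1 (scan (tape_at c 0)) (scan (tape_at c 3)) = Some (q, (J, act)) ->
  exists c', [/\ oracle_step oracle c = Some c', c'.1 = q
    & forall i, i < 6 ->
      tape_at c' i = if i \in J then shift act.2 (write act.1 (tape_at c i))
                     else write (scan (tape_at c i)) (tape_at c i)].
Proof.
move=> notAsk E.
have [|c' [Ec' Dq Dt]] := @machine_step_act_on _ _ search c q J act.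
  by move: E; rewrite -!scan_tape_at /= => ->.
exists c'; split=> //.
by rewrite /oracle_step /=; case: c.1 notAsk.
Qed.

(** * Tape invariants and phases of the search *)

Definition cells s : seq (option (symbol search)) := map Some (map inl s).

Lemma cells_cat s u : cells (s ++ u) = cells s ++ cells u.
Proof. by rewrite /cells !map_cat. Qed.

Lemma pmap_cells s : pmap id (cells s) = map inl s.
Proof. by rewrite /cells; elim: s => //= a s ->. Qed.

(** The loop invariant. Tapes 2, 4 and 5 are described by their query strings only, since idle tapes
    may gain explicit blanks; [T] is exact because the counter's head must be tracked. *)
Definition searching e T c :=
  [/\ query_string c 2 = e, query_string c 4 = [::], query_string c 5 = [::],
      tape_at c 1 = T & tape_at c 3 = T].

Lemma query_string_contents c c' i :
  contents (tape_at c' i) = contents (tape_at c i) ->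
  query_string c' i = query_string c i.
Proof. by rewrite /query_string => ->. Qed.

Lemma search_step_counter e T c q act :
    c.1 != Ask -> searching e T c ->
    search_actions c.1 (scan (tape_at c 0)) (scan (tape_at c 3)) = Some (q, ([:: 1; 3], act)) ->
  exists c', [/\ oracle_step oracle c = Some c', c'.1 = q
    & searching e (shift act.2 (write act.1 T)) c'].
Proof.
move=> notAsk [q2 q4 q5 t1 t3] /(search_step notAsk)[c' [E Dq Dt]].
exists c'; split=> //; split; rewrite ?Dt ?t1 ?t3 //.
- by rewrite -q2; apply: query_string_contents; rewrite Dt // contents_write_scan.
- by rewrite -q4; apply: query_string_contents; rewrite Dt // contents_write_scan.
- by rewrite -q5; apply: query_string_contents; rewrite Dt // contents_write_scan.
Qed.

(** The paddings [k] and [j] account for blanks made explicit by earlier steps. *)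
Definition counter k s j : tape (symbol search) :=
  Tape (nseq k None) (cells s ++ nseq j None).

(** Induction on the uncopied part [x], with [y] already on tape 2. The head of tape 2 ends past the
    copy, which a query string does not see. *)
Lemma run_copy l x y j c :
    c.1 = Copy -> tape_at c 0 = Tape l (cells x) ->
    tape_at c 2 = Tape (rev (cells y)) [::] ->
    query_string c 4 = [::] -> query_string c 5 = [::] ->
    tape_at c 1 = counter 0 [::] j -> tape_at c 3 = counter 0 [::] j ->
  exists j' c', [/\ run c c', c'.1 = Ask & searching (y ++ x) (counter 0 [::] j') c'].
Proof.
(* Rewriting the blank under the head makes it explicit: padding 0 becomes 1, any other is
   unchanged. *)
have wcounter i : write (scan (counter 0 [::] i)) (counter 0 [::] i)
    = counter 0 [::] i.-1.+1 by case: i.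
elim: x l y j c => [|a x IHx] l y j c Dq t0 t2 q4 q5 t1 t3.
  have [||c' [E Dq' Dt]] := @search_step c Ask [::] (None, Stay).
  - by rewrite Dq.
  - by rewrite Dq t0.
  exists j.-1.+1, c'; split=> //; first exact/(reaches_step E)/reaches_refl.
  split; try by rewrite Dt ?t1 ?t3 ?wcounter.
  - rewrite /query_string Dt // contents_write_scan t2 /contents /= revK cats0.
    by rewrite cats0 pmap_cells; elim: (y) => //= b y' ->.
  - by rewrite -q4; apply: query_string_contents; rewrite Dt // contents_write_scan.
  - by rewrite -q5; apply: query_string_contents; rewrite Dt // contents_write_scan.
have [||c' [E Dq' Dt]] :=
  @search_step c Copy [:: 0; 2] (Some (inl a), MoveRight).
- by rewrite Dq.
- by rewrite Dq t0.
have [] := IHx (Some (inl a) :: l) (rcons y a) j.-1.+1 c' Dq'.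
- by rewrite Dt // t0.
- by rewrite Dt // t2 /= -cats1 cells_cat rev_cat.
- by rewrite -q4; apply: query_string_contents; rewrite Dt // contents_write_scan.
- by rewrite -q5; apply: query_string_contents; rewrite Dt // contents_write_scan.
- by rewrite Dt // t1 wcounter.
- by rewrite Dt // t3 wcounter.
move=> j' [c'' [r Dq'' S]]; exists j', c''; split=> //; first exact: reaches_step r.
by rewrite -cat_rcons.
Qed.

(** The run follows the recursion of [successor]: [u] collects the digits already reset by carries,
    and [u'], [s'] split the result at the cell where the carry stops. *)
Lemma run_increment (a0 : Sigma) e u k s j c :
    c.1 = Increment ->
    searching e (Tape (rev (cells u) ++ nseq k None) (cells s ++ nseq j None)) c ->
  exists u' s' j' c', [/\ run c c', c'.1 = Rewind, u' ++ s' = u ++ successor s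
    & searching e (shift MoveLeft
        (Tape (rev (cells u') ++ nseq k None) (cells s' ++ nseq j' None))) c'].
Proof.
elim: s u j c => [|a s IHs] u j c Dq S; have [_ _ _ _ t3] := S.
  (* The letter [a0] makes the alphabet nonempty, so the blank past the last digit receives a
     letter. *)
  have [b Db] : exists b, enum Sigma = b :: behead (enum Sigma).
    have := mem_enum Sigma a0; rewrite inE.
    by case: (enum Sigma) => // b t _; exists b.
  have [||c' [E Dq' S']] :=
    @search_step_counter e _ c Rewind (Some (inl b), MoveLeft) _ S.
  - by rewrite Dq.
  - by rewrite Dq t3; case: (j) => [|j'] /=; rewrite Db.
  (* The new digit uses up one padding blank, if there is any. *)
  exists u, [:: b], j.-1, c'; split=> //; first exact/(reaches_step E)/reaches_refl.
  - by rewrite /= Db /= take0.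
  - by move: S'; case: (j).
case Db: (next_letter a) => [b|].
  have [||c' [E Dq' S']] :=
    @search_step_counter e _ c Rewind (Some (inl b), MoveLeft) _ S.
  - by rewrite Dq.
  - by rewrite Dq t3 /= Db.
  exists u, (b :: s), j, c'; split=> //; first exact/(reaches_step E)/reaches_refl.
  by rewrite /= Db.
set b := head a (enum Sigma).
have [||c' [E Dq' S']] :=
  @search_step_counter e _ c Increment (Some (inl b), MoveRight) _ S.
- by rewrite Dq.
- by rewrite Dq t3 /= Db.
have [] := IHs (rcons u b) j c' Dq'.
  by move: S'; rewrite -cats1 cells_cat rev_cat.
move=> u' [s' [j' [c'' [r Dq'' Ds S'']]]]; exists u', s', j', c''; split=> //.
  exact: reaches_step r.
by rewrite Ds /= Db cat_rcons.
Qed.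

(** Induction on [u] from its right end: each move left hands its last letter over to [s]. *)
Lemma run_rewind e u k s j c :
    c.1 = Rewind ->
    searching e (shift MoveLeft
      (Tape (rev (cells u) ++ nseq k None) (cells s ++ nseq j None))) c ->
  exists c', [/\ run c c', c'.1 = Ask & searching e (counter k.-1.+1 (u ++ s) j) c'].
Proof.
elim/last_ind: u s c => [|u a IHu] s c Dq S; have [_ _ _ _ t3] := S.
  (* The head is on the blank before the first digit; stepping right leaves that blank explicit,
     hence [k.-1.+1]. *)
  have [||c' [E Dq' S']] :=
    @search_step_counter e _ c Ask (None, MoveRight) _ S.
  - by rewrite Dq.
  - by rewrite Dq t3; case: (k).
  exists c'; split=> //; first exact/(reaches_step E)/reaches_refl.
  by move: S'; case: (k).
move: S t3; rewrite -cats1 cells_cat rev_cat => S t3.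
have [||c' [E Dq' S']] :=
  @search_step_counter e _ c Rewind (Some (inl a), MoveLeft) _ S.
- by rewrite Dq.
- by rewrite Dq t3.
have [c'' [r Dq'' S'']] := IHu (a :: s) c' Dq' S'.
by exists c''; split=> //; [exact: reaches_step r | rewrite -catA].
Qed.

Lemma query_counter e k s j c : searching e (counter k s j) c ->
  query_string c 3 = s /\ contents (tape_at c 1) = map inl s.
Proof.
case=> _ _ _ t1 t3.
have Dc : contents (counter k s j) = map inl s.
  rewrite /contents /= !pmap_cat rev_nseq !pmap_id_nseq_None cats0.
  exact: pmap_cells.
rewrite t1 /query_string t3 Dc; split=> //.
by elim: (s) => //= a s' ->.
Qed.

Lemma run_ask e k s j c :
    c.1 = Ask -> searching e (counter k s j) c ->
  oracle_step oracle c =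
    Some (if oracle e s (empty_context Sigma) then Found else Increment, c.2).
Proof.
move=> Dq S; have [q3 _] := query_counter S; have [q2 q4 q5 _ _] := S.
by rewrite /oracle_step /= Dq q2 q3 q4 q5.
Qed.

(** One round of the loop: a negative answer, an increment, a rewind. *)
Lemma run_next e k s j c :
    c.1 = Ask -> searching e (counter k s j) c ->
    (exists a0 : Sigma, True) -> ~~ oracle e s (empty_context Sigma) ->
  exists k' j' c',
    [/\ run c c', c'.1 = Ask & searching e (counter k' (successor s) j') c'].
Proof.
move=> Dq S [a0 _] /negPf no; have := run_ask Dq S; rewrite no => E.
have [||u [s' [j' [c2 [r2 Dq2 Ds S2]]]]] :=
  @run_increment a0 e [::] k s j (Increment, c.2) => //.
have [c3 [r3 Dq3 S3]] := run_rewind Dq2 S2.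
exists k.-1.+1, j', c3; split=> //; last by rewrite -[successor s]Ds.
exact/(reaches_step E)/(reaches_trans r2).
Qed.

Lemma run_start e : exists j c,
  [/\ run (initial search [:: e]) c, c.1 = Ask & searching e (counter 0 [::] j) c].
Proof.
have tape_initial i : i < 6 -> tape_at (initial search [:: e]) i =
    load (map (fun a => inl a : symbol search) (nth [::] [:: e] i)).
  by move=> lti; rewrite /tape_at (nth_mktuple _ _ (Ordinal lti : 'I_(6 + 0))).
by apply: (@run_copy [::] e [::] 0);
  rewrite /query_string ?tape_initial.
Qed.

(** Incrementing requires a letter to write; over an empty alphabet the search has to succeed at the
    first query, hence the last alternative. *)
Lemma search_computes e n :
    oracle e (iter n (@successor Sigma) [::]) (empty_context Sigma) ->
    (forall m, m < n ->
      ~~ oracle e (iter m (@successor Sigma) [::]) (empty_context Sigma)) ->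
    (exists a0 : Sigma, True) \/ n = 0 ->
  oracle_computes oracle e
    (map (fun a => inl a : symbol search) (iter n (@successor Sigma) [::])).
Proof.
move=> yes no inh.
have [k [j [c [r Dq S]]]] : exists k j c, [/\ run (initial search [:: e]) c,
    c.1 = Ask & searching e (counter k (iter n (@successor Sigma) [::]) j) c].
  (* The induction runs through rejected candidates, so the positive answer at [n] is set aside. *)
  elim: n no inh {yes} => [|n IHn] no inh.
    by have [j [c H]] := run_start e; exists 0, j, c.
  case: inh => // inh.
  have [|| k [j [c [r Dq S]]]] := IHn; [by move=> m /ltnW/no | by left |].
  have [k' [j' [c' [r' Dq' S']]]] := run_next Dq S inh (no n (ltnSn n)).
  by exists k', j', c'; split=> //; apply: reaches_trans r'.
have := run_ask Dq S; rewrite yes => E.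
exists (Found, c.2); split; last by have [] := query_counter S.
by split=> //; apply: (reaches_trans r); apply/(reaches_step E)/reaches_refl.
Qed.

End Search.

(** * The comparing machine *)

Section Compare.
Variable A : finType.

(* The state records whether the prefixes read so far agree. *)
Definition compare_actions (q : bool) (x y : option (A + void)) :
    option (bool * (seq nat * (option (A + void) * move))) :=
  if ~~ q then None
  else if x != y then Some (false, ([::], (None, Stay)))
  else if x is None then None
  else Some (true, ([:: 0; 1], (x, MoveRight))).

Definition compare_machine : machine A 4 :=
  @Machine A 4 void 0 bool true
    (fun q cells =>
       if compare_actions q (nth None cells 0) (nth None cells 1)
         is Some (q', (J, act)) then Some (q', act_on J act cells)
       else None).

Definition compare : decider A 4 := @Decider A 4 compare_machine id.

Lemma compare_halt (c : config compare) :
    compare_actions c.1 (scan (tape_at c 0)) (scan (tape_at c 1)) = None ->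
  machine_step c = None.
Proof. by rewrite /machine_step -!scan_tape_at /= => ->. Qed.

Lemma compare_step (c : config compare) q J act :
    compare_actions c.1 (scan (tape_at c 0)) (scan (tape_at c 1)) =
      Some (q, (J, act)) ->
  exists c', [/\ machine_step c = Some c', c'.1 = q
    & forall i, i < 4 ->
      tape_at c' i = if i \in J then shift act.2 (write act.1 (tape_at c i))
                     else write (scan (tape_at c i)) (tape_at c i)].
Proof.
move=> E; apply: (@machine_step_act_on _ _ compare c q J act).
by move: E; rewrite -!scan_tape_at /= => ->.
Qed.

(** Blanks follow both strings, so a difference in length shows up as a blank against a letter. *)
Lemma compare_run (u v : seq A) l l' (c : config compare) :
    c.1 = true ->
    tape_at c 0 = Tape l (map Some (map inl u)) ->
    tape_at c 1 = Tape l' (map Some (map inl v)) ->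
  exists c', halts_at (@machine_step _ _ compare) c c' /\ c'.1 = (u == v).
Proof.
elim: u v l l' c => [|a u IHu] [|b v] l l' c Dq t0 t1.
- exists c; split=> //; split; first exact: reaches_refl.
  by apply: compare_halt; rewrite Dq t0 t1.
- have [|c' [E Dq' _]] := @compare_step c false [::] (None, Stay).
    by rewrite Dq t0 t1.
  exists c'; split=> //; split; first exact/(reaches_step E)/reaches_refl.
  by apply: compare_halt; rewrite Dq'.
- have [|c' [E Dq' _]] := @compare_step c false [::] (None, Stay).
    by rewrite Dq t0 t1.
  exists c'; split=> //; split; first exact/(reaches_step E)/reaches_refl.
  by apply: compare_halt; rewrite Dq'.
have eq_cells : (Some (inl a) == Some (inl b) :> option (A + void)) = (a == b) by [].
rewrite eqseq_cons; have [Dab|neq_ab] := eqVneq a b; last first.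
  have [|c' [E Dq' _]] := @compare_step c false [::] (None, Stay).
    by rewrite Dq t0 t1 /compare_actions /= eq_cells neq_ab.
  exists c'; split=> //; split; first exact/(reaches_step E)/reaches_refl.
  by apply: compare_halt; rewrite Dq'.
have [|c1 [E Dq1 Dt]] := @compare_step c true [:: 0; 1] (Some (inl a), MoveRight).
  by rewrite Dq t0 t1 /compare_actions /= eq_cells Dab eqxx.
have [|| c2 [[r halt] Dq2]] := IHu v (Some (inl a) :: l) (Some (inl a) :: l') c1 Dq1.
- by rewrite Dt // t0.
- by rewrite Dt // t1.
by exists c2; split=> //; split=> //; apply: reaches_step r.
Qed.

Lemma compare_decides (o o' l r : seq A) :
  decides compare [:: o; o'; l; r] (o == o').
Proof.
apply: (@compare_run o o' [::] [::]) => //.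
- by rewrite /tape_at (nth_mktuple _ _ (Ordinal (isT : 0 < 4 + 0))).
- by rewrite /tape_at (nth_mktuple _ _ (Ordinal (isT : 1 < 4 + 0))).
Qed.

End Compare.

(** * Emulation of strongly transparent languages *)

Theorem theorem1 (Sigma : finType) (Y : countType) (null : Y) :
  emulatable null (fun L : language Sigma Y => strongly_transparent null L).
Proof.
exists (search Sigma), (compare _) => L transparent kappa e e' supp_e supp_e'.
(* On the support of [kappa], transparency leaves only the alternative with equal denotations. *)
have den_empty x : supp null L kappa x ->
    den L x kappa = den L x (empty_context Sigma).
  by move=> supp_x; case: (transparent x kappa) => [[]|/supp_x].
pose agree x n := assertion_oracle L x (iter n (@successor Sigma) [::])
                    (empty_context Sigma).
(* The enumeration reaches [x] itself, which agrees with [x]. *)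
have ex_agree x : exists n, agree x n.
  by have [n Dn] := successor_onto x; exists n; rewrite /agree Dn /assertion_oracle.
have computes x n : agree x n -> (forall m, agree x m -> n <= m) ->
    oracle_computes (mu := search Sigma) (assertion_oracle L) x
      (map inl (iter n (@successor Sigma) [::])).
  move=> agree_n min_n; apply: search_computes => // [m lt_mn|].
    by apply: contraL lt_mn => /min_n; rewrite leqNgt.
  (* A nonempty [x] supplies a letter; the empty [x] is string number 0, and minimality forces
     [n = 0]. *)
  case: x agree_n min_n => [|a x] _ min_n; last by left; exists a.
  by right; apply/eqP; rewrite -leqn0 min_n // /agree /assertion_oracle.
case: (ex_minnP (ex_agree e)) => n agree_n min_n.
case: (ex_minnP (ex_agree e')) => n' agree_n' min_n'.
exists (map inl (iter n (@successor Sigma) [::])),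
       (map inl (iter n' (@successor Sigma) [::])).
eexists; split; [exact: computes | exact: computes | exact: compare_decides |].
rewrite !den_empty // (inj_eq (inj_map _)) => [|a b [] //].
split=> [eq_den | /eqP eq_rep].
  (* Equal denotations give the same accepted indices, hence the same least one. *)
  have eq_agree m : agree e m = agree e' m by rewrite /agree /assertion_oracle eq_den.
  suff -> : n = n' by [].
  by apply/eqP; rewrite eqn_leq min_n ?min_n' // ?eq_agree // -eq_agree.
(* Conversely, each expression has the denotation of its representative in the empty context. *)
by rewrite (eqP agree_n) eq_rep -(eqP agree_n').
Qed.
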